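(* Let $A$ be a commutative ring with unity with a semi-transition map $\psi:A\to\mathcal{P}(\Lambda)$, let $S=\{a\in A\mid\psi(a)=\emptyset\}$, $A_S=S^{-1}A$, and let $\varphi:A_S\to\mathcal{P}(\Lambda)$, $\varphi(a/t)=\psi(a)$, be the associated semi-transition map. Then: (a) If $P$ is a prime $\varphi$-ideal in $A_S$ (a prime ideal that is a $\varphi$-ideal), then $\varphi[P]=\{\varphi(a)\mid a\in P\}$ is a prime $\varphi$-filter. (b) If $\mathscr{F}$ is a prime $\varphi$-filter on $\Lambda$, then $\varphi^{-1}[\mathscr{F}]=\{a\in A_S\mid\varphi(a)\in\mathscr{F}\}$ is a prime $\varphi$-ideal.
   Context: All rings are commutative with unity. $\mathcal{P}(\Lambda)$ is the power set of $\Lambda$. For a ring $A$ and a nonempty set $\Lambda$, a map $\psi:A\to\mathcal{P}(\Lambda)$ is a semi-transition map on $A$ if: (i) $\psi(ab)=\psi(a)\cup\psi(b)$ for all $a,b\in A$; (ii) $\psi(1)=\emptyset$, and $\psi(a)=\Lambda$ if and only if $a=0$; (iii) for all $a,b\in A$ there is some $c$ in the ideal $(a,b)$ with $\psi(a)\cap\psi(b)=\psi(c)\subseteq\psi(a+b)$; moreover, if $\psi(a)\cap\psi(b)=\emptyset$, then the ideal $(a^m,b^n)$ is principal for some $m,n\in\mathbb{N}$ (positive integers). The set $S$ is multiplicatively closed, and the map $\varphi(a/t)=\psi(a)$ is well defined and is a semi-transition map on $A_S$. Write $\varphi(A_S)=\{\varphi(a)\mid a\in A_S\}$. A $\varphi$-filter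 on $\Lambda$ is a nonempty subfamily $\mathscr{F}$ of $\varphi(A_S)$ such that (i) $\emptyset\notin\mathscr{F}$; (ii) if $\varphi(a),\varphi(b)\in\mathscr{F}$ then $\varphi(a)\cap\varphi(b)\in\mathscr{F}$; (iii) if $\varphi(a)\in\mathscr{F}$, $\varphi(c)\in\varphi(A_S)$ and $\varphi(a)\subseteq\varphi(c)$, then $\varphi(c)\in\mathscr{F}$. A prime $\varphi$-filter is a $\varphi$-filter $\mathscr{F}$ such that whenever $\varphi(a)\cup\varphi(b)\in\mathscr{F}$, either $\varphi(a)\in\mathscr{F}$ or $\varphi(b)\in\mathscr{F}$. An ideal $I$ of $A_S$ is a $\varphi$-ideal if for $a\in A_S$, $\varphi(a)\in\varphi[I]=\{\varphi(b)\mid b\in I\}$ implies $a\in I$; that is, $I=\varphi^{-1}[\varphi[I]]$. *)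

(* Defs.v *)
From HB Require Import structures.
From mathcomp Require Import all_boot all_order all_algebra ring_quotient.
From mathcomp Require Import mathcomp_extra boolp classical_sets.
From mathcomp Require Import ring.

Set Implicit Arguments.
Unset Strict Implicit.
Unset Printing Implicit Defensive.

Import GRing.Theory.
Local Open Scope ring_scope.
Local Open Scope classical_set_scope.
Local Open Scope quotient_scope.

(* The ideals (a) and (a, b). *)
Definition ideal1 (R : comPzRingType) (a : R) : set R :=
  [set x * a | x in [set: R]].
Definition ideal2 (R : comPzRingType) (a b : R) : set R :=
  [set c | exists x y, c = x * a + y * b].
Definition principal (R : comPzRingType) (I : set R) : Prop :=
  exists d, I = ideal1 d.

Record semi_transition (A : comPzRingType) (Lam : Type) (psi : A -> set Lam)
  : Prop := SemiTransition {
  st_nonempty : [set: Lam] !=set0;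
  st_mul : forall a b, psi (a * b) = psi a `|` psi b;
  st_one : psi 1 = set0;
  st_full : forall a, psi a = setT <-> a = 0;
  st_meet : forall a b, exists c, [/\ ideal2 a b c,
              psi a `&` psi b = psi c & psi c `<=` psi (a + b)];
  st_principal : forall a b, psi a `&` psi b = set0 ->
              exists m n : nat, [/\ (0 < m)%N, (0 < n)%N
                                  & principal (ideal2 (a ^+ m) (b ^+ n))]
}.

(* Multiplicatively closed subsets; 0 is excluded so that the localization
   is a nonzero ring, as the library's theory of ideals requires. *)
Record mulset (R : comPzRingType) := MulSet {
  mulset_set :> set R;
  mulset_closed : mulr_closed [in mulset_set];
  mulset_0 : 0 \notin mulset_set
}.

Module Localization.
Section Localization.
Variables (R : comPzRingType) (S : mulset R).

Definition ratio : Type := (R * {t : R | t \in (S : set R)})%type.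
HB.instance Definition _ := Choice.on ratio.

Implicit Types x y z : ratio.

Lemma S1 : 1 \in (S : set R). Proof. exact: (mulset_closed S).1. Qed.

Lemma SM s t : s \in (S : set R) -> t \in (S : set R) ->
  s * t \in (S : set R).
Proof. exact: (mulset_closed S).2. Qed.

Definition den1 : {t : R | t \in (S : set R)} := exist _ 1 S1.
Definition denM (s t : {t : R | t \in (S : set R)}) :
  {t : R | t \in (S : set R)} := exist _ (val s * val t) (SM (valP s) (valP t)).

Definition equiv x y : bool :=
  `[< exists2 u, u \in (S : set R) & u * (x.1 * val y.2 - y.1 * val x.2) = 0 >].

Lemma equiv_refl : reflexive equiv.
Proof. by move=> x; apply/asboolP; exists 1; rewrite ?S1 // subrr mulr0. Qed.

Lemma equiv_sym : symmetric equiv.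
Proof.
suff H x y : equiv x y -> equiv y x by move=> x y; apply/idP/idP => /H.
move=> /asboolP[u Su h]; apply/asboolP; exists u => //.
by rewrite -opprB mulrN h oppr0.
Qed.

Lemma equiv_trans : transitive equiv.
Proof.
move=> y x z /asboolP[u Su hu] /asboolP[v Sv hv]; apply/asboolP.
exists (u * v * val y.2); first exact: SM (SM Su Sv) (valP _).
have -> : u * v * val y.2 * (x.1 * val z.2 - z.1 * val x.2) =
  v * val z.2 * (u * (x.1 * val y.2 - y.1 * val x.2)) +
  u * val x.2 * (v * (y.1 * val z.2 - z.1 * val y.2)) by ring.
by rewrite hu hv !mulr0 addr0.
Qed.

Canonical equiv_equiv := EquivRel equiv equiv_refl equiv_sym equiv_trans.

Definition type := {eq_quot equiv}.
HB.instance Definition _ : EqQuotient _ equiv type := EqQuotient.on type.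
HB.instance Definition _ := Choice.on type.

Lemma piP x y : reflect (\pi_type x = \pi_type y)
  `[< exists2 u, u \in (S : set R) & u * (x.1 * val y.2 - y.1 * val x.2) = 0 >].
Proof. by apply: (iffP idP) => [h | /eqmodP//]; apply/eqmodP. Qed.

Lemma equiv_repr x :
  exists2 u, u \in (S : set R) &
    u * (x.1 * val (repr (\pi_type x)).2 - (repr (\pi_type x)).1 * val x.2) = 0.
Proof. by apply/asboolP/piP; rewrite reprK. Qed.

Definition zeror : ratio := (0, den1).
Definition oner : ratio := (1, den1).
Definition addr x y : ratio :=
  (x.1 * val y.2 + y.1 * val x.2, denM x.2 y.2).
Definition oppr x : ratio := (- x.1, x.2).
Definition mulr x y : ratio := (x.1 * y.1, denM x.2 y.2).

Definition zero := \pi_type zeror.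
Definition one := \pi_type oner.
Definition add := lift_op2 type addr.
Definition opp := lift_op1 type oppr.
Definition mul := lift_op2 type mulr.

Lemma pi_add : {morph \pi_type : x y / addr x y >-> add x y}.
Proof.
move=> x y; unlock add; apply/piP/asboolP.
have [u Su hu] := equiv_repr x; have [v Sv hv] := equiv_repr y.
set x' := repr _ in hu *; set y' := repr _ in hv *.
exists (u * v); first exact: SM.
transitivity
  (v * val y.2 * val y'.2 * (u * (x.1 * val x'.2 - x'.1 * val x.2)) +
   u * val x.2 * val x'.2 * (v * (y.1 * val y'.2 - y'.1 * val y.2))).
  by rewrite /=; ring.
by rewrite hu hv !mulr0 addr0.
Qed.

Lemma pi_opp : {morph \pi_type : x / oppr x >-> opp x}.
Proof.
move=> x; unlock opp; apply/piP/asboolP.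
have [u Su hu] := equiv_repr x; exists u => //=.
by rewrite !mulNr -opprD mulrN hu oppr0.
Qed.

Lemma pi_mul : {morph \pi_type : x y / mulr x y >-> mul x y}.
Proof.
move=> x y; unlock mul; apply/piP/asboolP.
have [u Su hu] := equiv_repr x; have [v Sv hv] := equiv_repr y.
set x' := repr _ in hu *; set y' := repr _ in hv *.
exists (u * v); first exact: SM.
transitivity
  (v * y.1 * val y'.2 * (u * (x.1 * val x'.2 - x'.1 * val x.2)) +
   u * x'.1 * val x.2 * (v * (y.1 * val y'.2 - y'.1 * val y.2))).
  by rewrite /=; ring.
by rewrite hu hv !mulr0 addr0.
Qed.

Lemma pi_eq x y : x.1 * val y.2 = y.1 * val x.2 -> \pi_type x = \pi_type y.
Proof.
by move=> h; apply/piP/asboolP; exists 1; rewrite ?S1// h subrr mulr0.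
Qed.

Lemma addA : associative add.
Proof.
elim/quotW=> x; elim/quotW=> y; elim/quotW=> z.
by rewrite -!pi_add; apply: pi_eq => /=; ring.
Qed.

Lemma addC : commutative add.
Proof.
by elim/quotW=> x; elim/quotW=> y; rewrite -!pi_add; apply: pi_eq => /=; ring.
Qed.

Lemma add0 : left_id zero add.
Proof. by elim/quotW=> x; rewrite -!pi_add; apply: pi_eq => /=; ring. Qed.

Lemma addN : left_inverse zero opp add.
Proof.
by elim/quotW=> x; rewrite -pi_opp -!pi_add; apply: pi_eq => /=; ring.
Qed.

HB.instance Definition _ := GRing.isZmodule.Build type addA addC add0 addN.

Lemma mulA : associative mul.
Proof.
elim/quotW=> x; elim/quotW=> y; elim/quotW=> z.
by rewrite -!pi_mul; apply: pi_eq => /=; ring.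
Qed.

Lemma mulC : commutative mul.
Proof.
by elim/quotW=> x; elim/quotW=> y; rewrite -!pi_mul; apply: pi_eq => /=; ring.
Qed.

Lemma mul1 : left_id one mul.
Proof. by elim/quotW=> x; rewrite -!pi_mul; apply: pi_eq => /=; ring. Qed.

Lemma mulDl : left_distributive mul add.
Proof.
elim/quotW=> x; elim/quotW=> y; elim/quotW=> z.
by rewrite -!(pi_mul, pi_add); apply: pi_eq => /=; ring.
Qed.

Lemma one_neq0 : one != zero.
Proof.
apply/eqP => /piP/asboolP[u Su] /=.
rewrite mul0r subr0 !mulr1 => u0.
by have := mulset_0 S; rewrite -u0 Su.
Qed.

HB.instance Definition _ :=
  GRing.Zmodule_isComNzRing.Build type mulA mulC mul1 mulDl one_neq0.

End Localization.
End Localization.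
HB.export Localization.

(* loc S is the ring of fractions of R with denominators in S, and
   frac S a t the fraction a / t. *)
Notation loc := Localization.type.

Definition frac (R : comPzRingType) (S : mulset R) (a : R)
  (t : {t : R | t \in (S : set R)}) : loc S := \pi_(loc S) (a, t).

Section LocalizationTheory.
Variables (R : comPzRingType) (S : mulset R).
Implicit Types (a b : R) (s t : {t : R | t \in (S : set R)}).

Lemma fracP (x : loc S) : exists a t, x = frac a t.
Proof. by elim/quotW: x => -[a t]; exists a, t. Qed.

Lemma eq_fracP a b s t : frac a s = frac b t <->
  exists2 u, u \in (S : set R) & u * (a * val t - b * val s) = 0.
Proof.
split; first by move/Localization.piP/asboolP.
by move=> h; apply/Localization.piP/asboolP.
Qed.

Lemma frac0 : frac 0 (Localization.den1 S) = 0. Proof. by []. Qed.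

Lemma frac1 : frac 1 (Localization.den1 S) = 1. Proof. by []. Qed.

Lemma fracD a b s t :
  frac a s + frac b t = frac (a * val t + b * val s) (Localization.denM s t).
Proof. by rewrite /frac [RHS](Localization.pi_add (a, s) (b, t)). Qed.

Lemma fracM a b s t :
  frac a s * frac b t = frac (a * b) (Localization.denM s t).
Proof. by rewrite /frac [RHS](Localization.pi_mul (a, s) (b, t)). Qed.

Lemma eq_frac a b s t : a * val t = b * val s -> frac a s = frac b t.
Proof. exact: (@Localization.pi_eq _ _ (a, s) (b, t)). Qed.

End LocalizationTheory.

Section SemiTransitionLocalization.
Variables (A : comPzRingType) (Lam : Type) (psi : A -> set Lam).
Hypothesis hpsi : semi_transition psi.

Lemma st_zero : psi 0 = setT. Proof. by apply/(st_full hpsi). Qed.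

Lemma kernel_closed : mulr_closed [in [set a | psi a = set0]].
Proof.
split; first by rewrite !inE /=; exact: st_one hpsi.
move=> a b; rewrite !inE /= => ha hb.
by rewrite (st_mul hpsi) ha hb setU0.
Qed.

Lemma kernel_0 : 0 \notin [set a | psi a = set0].
Proof.
rewrite notin_setE /= st_zero => h.
by have [l _] := st_nonempty hpsi; have : [set: Lam] l by []; rewrite h.
Qed.

Definition kernel : mulset A := MulSet kernel_closed kernel_0.

(* The value does not depend on the representative of x: see phi_frac. *)
Definition phi (x : loc kernel) : set Lam := psi (repr x).1.

Lemma psi_den (t : {t : A | t \in (kernel : set A)}) : psi (val t) = set0.
Proof. by have := valP t; rewrite inE. Qed.

Lemma phi_frac a (t : {t : A | t \in (kernel : set A)}) :
  phi (frac a t) = psi a.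
Proof.
have : frac (repr (frac a t)).1 (repr (frac a t)).2 = frac a t.
  by rewrite {1}/frac -surjective_pairing reprK.
rewrite /phi; case: (repr _) => b s /= /eq_fracP[u].
rewrite inE /= => hu /eqP; rewrite mulrBr subr_eq0 => /eqP /(congr1 psi).
by rewrite !(st_mul hpsi) hu !psi_den !set0U !setU0.
Qed.

Lemma phi_semi_transition : semi_transition phi.
Proof.
have den_l a (s : {t : A | t \in (kernel : set A)}) : psi (a * val s) = psi a.
  by rewrite (st_mul hpsi) (psi_den s) setU0.
split.
- exact: st_nonempty hpsi.
- move=> x y; have [a [s ->]] := fracP x; have [b [t ->]] := fracP y.
  by rewrite fracM !phi_frac (st_mul hpsi).
- by rewrite -frac1 phi_frac (st_one hpsi).
- move=> x; split=> [|->]; last by rewrite -frac0 phi_frac st_zero.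
  have [a [s ->]] := fracP x; rewrite phi_frac => /(st_full hpsi) ->.
  by rewrite -frac0; apply: eq_frac; rewrite !mul0r.
- move=> x y; have [a [s ->]] := fracP x; have [b [t ->]] := fracP y.
  have [c [[p [q hc]] h1 h2]] := st_meet hpsi (a * val t) (b * val s).
  exists (frac c (Localization.den1 kernel)); split.
  + exists (frac (p * val t * val s) (Localization.den1 kernel)).
    exists (frac (q * val s * val t) (Localization.den1 kernel)).
    by rewrite !fracM fracD; apply: eq_frac; rewrite hc /=; ring.
  + by rewrite !phi_frac -h1 !den_l.
  + by rewrite fracD !phi_frac.
- move=> x y; have [a [s ->]] := fracP x; have [b [t ->]] := fracP y.
  rewrite !phi_frac => h0.
  have [m [n [m0 n0 [d hd]]]] := st_principal hpsi h0.
  exists m, n; split=> //; exists (frac d (Localization.den1 kernel)).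
  pose i (p : A) : loc kernel := frac p (Localization.den1 kernel).
  have iD p q : i (p + q) = i p + i q.
    by rewrite /i fracD; apply: eq_frac => /=; ring.
  have iM p q : i (p * q) = i p * i q.
    by rewrite /i fracM; apply: eq_frac => /=; ring.
  have iX p k : i (p ^+ k) = i p ^+ k.
    by elim: k => [|k IH]; rewrite ?frac1 // !exprS iM IH.
  have unit_l p (r : {t : A | t \in (kernel : set A)}) :
      exists v, i p = v * frac p r /\
        exists w, frac p r = w * i p.
    exists (i (val r)); split.
      by rewrite fracM; apply: eq_frac => /=; ring.
    by exists (frac 1 r); rewrite fracM; apply: eq_frac => /=; ring.
  have [v [hv [v' hv']]] := unit_l a s.
  have [w [hw [w' hw']]] := unit_l b t.
  apply/seteqP; split=> z.
  + move=> [p [q ->]].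
    have [k _ hk] : ideal1 d (a ^+ m).
      by rewrite -hd; exists 1, 0; rewrite mul1r mul0r addr0.
    have [l _ hl] : ideal1 d (b ^+ n).
      by rewrite -hd; exists 0, 1; rewrite mul1r mul0r add0r.
    exists (p * v' ^+ m * i k + q * w' ^+ n * i l) => //.
    rewrite hv' hw' !exprMn -!iX -hk -hl !iM /i; ring.
  + move=> [k _ <-].
    have [p [q ->]] : ideal2 (a ^+ m) (b ^+ n) d.
      by rewrite hd; exists 1; rewrite ?mul1r.
    exists (k * i p * v ^+ m), (k * i q * w ^+ n).
    rewrite -[frac (_ + _) _]/(i (_ + _)) iD !iM !iX hv hw !exprMn; ring.
Qed.

End SemiTransitionLocalization.

Arguments phi {A Lam psi} hpsi x.

Section Filters.
Variables (T : Type) (Lam : Type) (phi : T -> set Lam).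

Record phi_filter (F : set (set Lam)) : Prop := PhiFilter {
  pf_nonempty : F !=set0;
  pf_sub : F `<=` range phi;
  pf_set0 : ~ F set0;
  pf_meet : forall a b, F (phi a) -> F (phi b) -> F (phi a `&` phi b);
  pf_up : forall a c, F (phi a) -> phi a `<=` phi c -> F (phi c)
}.

Definition prime_phi_filter (F : set (set Lam)) : Prop :=
  phi_filter F /\
  forall a b, F (phi a `|` phi b) -> F (phi a) \/ F (phi b).

End Filters.

Section Ideals.
Variables (R : comNzRingType) (Lam : Type) (phi : R -> set Lam).

(* An ideal of R is a submodule of the regular module R^o; the library's
   idealr_closed also demands that it be proper. *)
Definition phi_ideal (I : set R) : Prop :=
  submod_closed ([in I] : {pred R^o}) /\
  forall a, (phi @` I) (phi a) -> I a.

Definition prime_ideal (I : set R) : Prop :=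
  idealr_closed [in I] /\ prime_idealr_closed [in I].

Definition prime_phi_ideal (I : set R) : Prop :=
  prime_ideal I /\ phi_ideal I.

End Ideals.

(* Main.v *)
(* Unions of values of phi are values at products, which gives upward closure
   and primality; the element c of (a, b) with phi a `&` phi b = phi c, contained
   in phi (a + b), turns sums in an ideal into meets in a filter and back. *)
Require Import Defs.
From mathcomp Require Import all_boot all_order all_algebra.
From mathcomp Require Import boolp classical_sets.
Local Open Scope classical_set_scope.

Import GRing.Theory.

Section PrimeIdealsAndFilters.
Local Open Scope ring_scope.
Variables (R : comNzRingType) (Lam : Type) (phi : R -> set Lam).
Hypothesis hphi : semi_transition phi.

(** As [P] is a $\varphi$-ideal, a value [phi a] lies in the image only if [a] itself lies in [P],
    so each filter axiom reduces to a closure property of [P]. *)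
Lemma prime_phi_filter_image (P : set R) :
  prime_phi_ideal phi P -> prime_phi_filter phi (phi @` P).
Proof.
move=> [[[P0 P1 PD] Ppr] [_ Pphi]].
have PM r a : P a -> P (r * a).
  move=> Pa; have := PD r a 0.
  by rewrite addr0 !inE in P0 *; apply.
have PA a b : P a -> P b -> P (a + b).
  by move=> Pa Pb; have := PD 1 a b; rewrite mul1r !inE; apply.
split; last first.
  move=> a b; rewrite -(st_mul hphi) => /Pphi Pab.
  have /orP[] : (a \in P) || (b \in P) by apply: Ppr; rewrite inE.
    by rewrite inE => Pa; left; exists a.
  by rewrite inE => Pb; right; exists b.
split.
- by exists (phi 0), 0 => //; rewrite inE in P0.
- by move=> _ [a _ <-]; exists a.
(* The empty set is [phi 1], so it would put 1 in [P]. *)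
- by rewrite -(st_one hphi) => /Pphi P1'; rewrite notin_setE in P1.
- move=> a b /Pphi Pa /Pphi Pb.
  have [c [[x [y ->]] -> _]] := st_meet hphi a b.
  by exists (x * a + y * b) => //; apply: PA; exact: PM.
- move=> a c /Pphi Pa /setUidPr ac.
  (* The multiple [c * a] of [a] has value [phi c], which absorbs [phi a]. *)
  by exists (c * a); [exact: PM | rewrite (st_mul hphi) setUC].
Qed.

(** Membership of [a] in the preimage depends on [phi a] alone, which makes it a $\varphi$-ideal as
    soon as it is an ideal. *)
Lemma prime_phi_ideal_preimage (F : set (set Lam)) :
  prime_phi_filter phi F -> prime_phi_ideal phi (phi @^-1` F).
Proof.
move=> [[[U FU] Fsub F0 Fmeet Fup] Fpr].
(* Some value lies in [F], and the full set [phi 0] contains it. *)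
have I0 : F (phi 0).
  have [x _ xU] := Fsub _ FU; rewrite -xU in FU.
  apply: Fup FU _; have -> : phi 0 = setT by apply/(st_full hphi).
  exact: subsetT.
have IM r a : F (phi a) -> F (phi (r * a)).
  by move=> Fa; apply: Fup Fa _; rewrite (st_mul hphi); exact: subsetUr.
have IA a b : F (phi a) -> F (phi b) -> F (phi (a + b)).
  move=> Fa Fb; have [c [_ abc cD]] := st_meet hphi a b.
  by apply: Fup cD; rewrite -abc; exact: Fmeet.
have ID r a b : F (phi a) -> F (phi b) -> F (phi (r * a + b)).
  by move=> Fa Fb; apply: IA Fb; exact: IM.
split; split.
- split.
  + by rewrite inE.
  + by rewrite notin_setE /= (st_one hphi).
  + by move=> r a b; rewrite !inE; exact: ID.
- move=> a b; rewrite !inE /= (st_mul hphi) => /Fpr[Fa|Fb]; apply/orP.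
    by left; rewrite inE.
  by right; rewrite inE.
- split; first by rewrite inE.
  by move=> r a b; rewrite !inE; exact: ID.
- by move=> a [b Fb ab]; rewrite /= -ab.
Qed.

End PrimeIdealsAndFilters.

Theorem theorem3p9 (A : comPzRingType) (Lam : Type) (psi : A -> set Lam)
    (hpsi : semi_transition psi) :
  (forall P : set (loc (kernel hpsi)),
      prime_phi_ideal (phi hpsi) P ->
      prime_phi_filter (phi hpsi) (phi hpsi @` P)) /\
  (forall F : set (set Lam),
      prime_phi_filter (phi hpsi) F ->
      prime_phi_ideal (phi hpsi) (phi hpsi @^-1` F)).
Proof.
(* This carries both lemmas, stated over any nonzero ring, to $A_S$. *)
have hphi := phi_semi_transition hpsi.
split=> [P|F].
  exact: prime_phi_filter_image.
exact: prime_phi_ideal_preimage.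
Qed.
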